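(* As $x\to\infty$, $$\sum_{r\le x}N_4(1,r)=\frac{2}{7\,\zeta(3)}\,x^4+O(x^3).$$
   Context: For $r\in\mathbb{N}=\{1,2,\ldots\}$, $N_4(1,r)$ is the number of solutions $(x,y,z,t)\in(\mathbb{Z}/r\mathbb{Z})^4$ of $x^2+y^2+z^2+t^2\equiv 1\pmod r$. The sum runs over all positive integers $r\le x$. $\zeta$ is the Riemann zeta function. *)

(* Defs.v *)
From mathcomp Require Import all_boot all_order all_algebra.
From mathcomp Require Import all_classical all_reals all_analysis.

Set Implicit Arguments.
Unset Strict Implicit.
Unset Printing Implicit Defensive.

Import Order.TTheory GRing.Theory Num.Theory.
Import numFieldNormedType.Exports.

Local Open Scope ring_scope.

(* Residues mod [r] are represented by ['I_r] rather than ['Z_r] because ['Z_1]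
   denotes the two-element ring; here [r = 1] yields exactly one solution. *)
Definition N4 (n r : nat) : nat :=
  #|[set v : 'I_r * 'I_r * 'I_r * 'I_r |
      let: (x, y, z, t) := v in
      x ^ 2 + y ^ 2 + z ^ 2 + t ^ 2 == n %[mod r]]|%N.

(* The Riemann zeta function on its half-line of convergence [1 < s]. *)
Definition zeta (R : realType) (s : R) : R := limn (series (riemannR s)).

(* Landau notations take a bundled filter, and [pinfty_nbhs] is only registered
   as an instance of the [ProperFilter] class. *)
Canonical pinfty_filter_on (R : numFieldType) : filter_on R :=
  FilterType (pinfty_nbhs R) _.

(* Main.v *)
(* Write [f r] for [N4 1 r]. The Chinese remainder theorem splits off the
   2-part, where [f (2 ^ k) = 8 ^ k]. For odd [m], a solution of
   [u^2 + v^2 = -1] mod [m] turns the sum of four squares into the determinant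
   of a 2x2 matrix, so [f m = #|SL_2(Z/m)| = m * J_2(m)] with [J_2] Jordan's
   totient. Since [J_2 * 1 = id^2], for every [r] the sum of [e * f (r / e)]
   over the odd divisors [e] of [r] is [r ^ 3], hence for [S] the summatory
   function of [f] the sum of [e * S (n / e)] over odd [e <= n] is
   [n ^ 4 / 4 + O(n ^ 3)]. Instead of a Moebius inversion, the bound
   [S n = c n ^ 4 + O(n ^ 3)], where [c] times the sum of the [1 / e ^ 3] over
   odd [e], i.e. [c * 7/8 * zeta 3], is [1/4], follows by strong induction:
   the error terms with [e >= 3] contribute at most half of the bound. *)
Require Import Defs.
From mathcomp Require Import all_boot all_order all_algebra.
From mathcomp Require Import all_classical all_reals all_analysis.
From mathcomp Require Import zify ring lra.

Import Order.TTheory GRing.Theory Num.Theory.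
Import numFieldNormedType.Exports.

Local Open Scope classical_set_scope.
Local Open Scope ring_scope.

(** * Solution counts as iterated sums over residues *)

(** Summing over plain numbers instead of ordinals lets the modulus change without casts, and lets
    one-variable identities act on each coordinate in turn. *)
Definition sum4 (n : nat) (F : nat -> nat -> nat -> nat -> nat) : nat :=
  (\sum_(0 <= x < n) \sum_(0 <= y < n) \sum_(0 <= z < n) \sum_(0 <= t < n)
     F x y z t)%N.

Definition sumsq (x y z t : nat) : nat := (x ^ 2 + y ^ 2 + z ^ 2 + t ^ 2)%N.

Lemma eq_sum4 (n : nat) (F G : nat -> nat -> nat -> nat -> nat) :
  (forall x y z t, F x y z t = G x y z t) -> sum4 n F = sum4 n G.
Proof.
move=> FG; do 4!(apply: eq_bigr => ? _); exact: FG.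
Qed.

Lemma N4_sum4 (r : nat) :
  N4 1 r = sum4 r (fun x y z t => sumsq x y z t == 1 %[mod r])%N.
Proof.
transitivity (\sum_(x < r) \sum_(y < r) \sum_(z < r) \sum_(t < r)
    (sumsq x y z t == 1 %[mod r]))%N; last first.
  rewrite /sum4 big_mkord; apply: eq_bigr => x _.
  rewrite big_mkord; apply: eq_bigr => y _.
  rewrite big_mkord; apply: eq_bigr => z _.
  by rewrite big_mkord.
rewrite !pair_bigA /= /N4 -sum1_card big_mkcond /=.
by apply: eq_bigr => -[[[x y] z] t] _; rewrite inE /sumsq; case: eqP.
Qed.

Lemma sum_modn (k r : nat) (F : nat -> nat) :
  (\sum_(0 <= x < k * r) F (x %% r) = k * \sum_(0 <= x < r) F x)%N.
Proof.
elim: k => [|k IH]; first by rewrite mul0n big_geq.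
rewrite mulSn mulSn -IH (@big_cat_nat _ _ _ r) //= ?leq_addr //; congr addn.
  by apply: eq_big_nat => i /andP[_ ir]; rewrite modn_small.
rewrite -[X in (\big[_/_]_(X <= _ < _) _)%N]add0n big_addn addKn.
by apply: eq_bigr => i _; rewrite modnDr.
Qed.

(** By the Chinese remainder theorem [x] is determined by its two remainders, and a count makes this
    injection a bijection onto the pairs. *)
Lemma sum_crt (a b : nat) (F G : nat -> nat) : (0 < a)%N -> (0 < b)%N ->
  coprime a b ->
  (\sum_(0 <= x < a * b) F (x %% a) * G (x %% b) =
   (\sum_(0 <= x < a) F x) * (\sum_(0 <= x < b) G x))%N.
Proof.
move=> a0 b0 cab; rewrite !big_mkord big_distrlr /=.
rewrite (pair_big xpredT xpredT (fun (i : 'I_a) (j : 'I_b) => F i * G j)%N) /=.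
pose phi (x : 'I_(a * b)) : 'I_a * 'I_b :=
  (Ordinal (ltn_pmod x a0), Ordinal (ltn_pmod x b0)).
have phi_inj : injective phi.
  move=> x y [xya xyb]; apply/ord_inj/eqP.
  by rewrite -(modn_small (ltn_ord x)) -(modn_small (ltn_ord y))
    chinese_remainder // xya xyb !eqxx.
by rewrite (reindex phi) //=; apply/onW_bij/inj_card_bij;
   rewrite // card_prod !card_ord.
Qed.

(** Multiplication by a unit permutes the residues. *)
Lemma sum_scale (n w : nat) (F : nat -> nat) : (0 < n)%N -> coprime n w ->
  (\sum_(0 <= x < n) F (w * x %% n) = \sum_(0 <= x < n) F x)%N.
Proof.
move=> n0 cnw; rewrite !big_mkord.
pose phi (x : 'I_n) : 'I_n := Ordinal (ltn_pmod (w * x) n0).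
rewrite [RHS](reindex phi) //=; apply/onW_bij/injF_bij => x y [].
wlog xy : x y / (x <= y)%N.
  by move=> H e; case/orP: (leq_total x y) => /H; [apply|move=> ->].
move/eqP; rewrite eq_sym eqn_mod_dvd ?leq_mul2l ?xy ?orbT //.
rewrite -mulnBr Gauss_dvdr // => /dvdnP[[|k] e].
  by apply/val_inj => /=; lia.
by have := ltn_ord y; nia.
Qed.

Lemma sum4_modn (k r : nat) (F : nat -> nat -> nat -> nat -> nat) :
  sum4 (k * r) (fun x y z t => F (x %% r) (y %% r) (z %% r) (t %% r))%N =
  (k ^ 4 * sum4 r F)%N.
Proof.
rewrite /sum4.
under eq_bigr => x _ do under eq_bigr => y _ do under eq_bigr => z _ do
  rewrite (sum_modn k r (fun t => F (x %% r) (y %% r) (z %% r) t)%N).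
under eq_bigr => x _ do under eq_bigr => y _ do
  rewrite -big_distrr /=
    (sum_modn k r (fun z => \sum_(0 <= t < r) F (x %% r) (y %% r) z t)%N).
under eq_bigr => x _ do
  rewrite -!big_distrr /= (sum_modn k r
    (fun y => \sum_(0 <= z < r) \sum_(0 <= t < r) F (x %% r) y z t)%N).
rewrite -!big_distrr /= (sum_modn k r
    (fun x => \sum_(0 <= y < r) \sum_(0 <= z < r) \sum_(0 <= t < r) F x y z t)%N).
by ring.
Qed.

Lemma sum4_crt (a b : nat) (F G : nat -> nat -> nat -> nat -> nat) :
  (0 < a)%N -> (0 < b)%N -> coprime a b ->
  sum4 (a * b) (fun x y z t => F (x %% a) (y %% a) (z %% a) (t %% a) *
                               G (x %% b) (y %% b) (z %% b) (t %% b))%N =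
  (sum4 a F * sum4 b G)%N.
Proof.
move=> a0 b0 cab; rewrite /sum4.
under eq_bigr => x _ do under eq_bigr => y _ do under eq_bigr => z _ do
  rewrite (sum_crt a b (fun t => F (x %% a) (y %% a) (z %% a) t)%N
                   (fun t => G (x %% b) (y %% b) (z %% b) t)%N) //.
under eq_bigr => x _ do under eq_bigr => y _ do
  rewrite (sum_crt a b (fun z => \sum_(0 <= t < a) F (x %% a) (y %% a) z t)%N
                   (fun z => \sum_(0 <= t < b) G (x %% b) (y %% b) z t)%N) //.
under eq_bigr => x _ do
  rewrite (sum_crt a b
    (fun y => \sum_(0 <= z < a) \sum_(0 <= t < a) F (x %% a) y z t)%N
    (fun y => \sum_(0 <= z < b) \sum_(0 <= t < b) G (x %% b) y z t)%N) //.
by rewrite (sum_crt a b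
  (fun x => \sum_(0 <= y < a) \sum_(0 <= z < a) \sum_(0 <= t < a) F x y z t)%N
  (fun x => \sum_(0 <= y < b) \sum_(0 <= z < b) \sum_(0 <= t < b) G x y z t)%N).
Qed.

Lemma sum4_scale (n w : nat) (F : nat -> nat -> nat -> nat -> nat) :
  (0 < n)%N -> coprime n w ->
  sum4 n (fun x y z t =>
    F (w * x %% n) (w * y %% n) (w * z %% n) (w * t %% n))%N = sum4 n F.
Proof.
move=> n0 cnw; rewrite /sum4.
under eq_bigr => x _ do under eq_bigr => y _ do under eq_bigr => z _ do
  rewrite (sum_scale n w (fun t =>
    F (w * x %% n) (w * y %% n) (w * z %% n) t)%N) //.
under eq_bigr => x _ do under eq_bigr => y _ do
  rewrite (sum_scale n w (fun z => \sum_(0 <= t < n)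
    F (w * x %% n) (w * y %% n) z t)%N) //.
under eq_bigr => x _ do
  rewrite (sum_scale n w (fun y => \sum_(0 <= z < n) \sum_(0 <= t < n)
    F (w * x %% n) y z t)%N) //.
by rewrite (sum_scale n w (fun x => \sum_(0 <= y < n) \sum_(0 <= z < n)
  \sum_(0 <= t < n) F x y z t)%N).
Qed.

Lemma addn_eqmod (r a b c d : nat) :
  (a = b %[mod r] -> c = d %[mod r] -> a + c = b + d %[mod r])%N.
Proof. by move=> ab cd; rewrite -modnDm ab cd modnDm. Qed.

Lemma sumsq_modn (x y z t r : nat) :
  (sumsq (x %% r) (y %% r) (z %% r) (t %% r) = sumsq x y z t %[mod r])%N.
Proof.
rewrite /sumsq; do 3!(apply: addn_eqmod; last exact: modnXm); exact: modnXm.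
Qed.

(** * Multiplicativity and the powers of two *)

Lemma N4_mul (a b : nat) : (0 < a)%N -> (0 < b)%N -> coprime a b ->
  N4 1 (a * b) = (N4 1 a * N4 1 b)%N.
Proof.
move=> a0 b0 cab; rewrite !N4_sum4 -sum4_crt //; apply: eq_sum4 => x y z t.
by rewrite chinese_remainder // !sumsq_modn mulnb.
Qed.

(* Scaling by [1 + r/2], whose square is [1 + r] modulo [2r], exchanges the
   classes [1] and [1 + r] of sums of squares. *)
Lemma N4_double (s : nat) : (0 < s)%N -> N4 1 (2 * (8 * s)) = (8 * N4 1 (8 * s))%N.
Proof.
move=> s0; set r := (8 * s)%N.
(* Each solution modulo [r] has 16 lifts modulo [2 * r], falling into the classes 1 and 1 + r; these
   two classes are shown to be equally large. *)
suff : (2 * N4 1 (2 * r) = 16 * N4 1 r)%N by lia.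
rewrite !N4_sum4 -(sum4_modn 2 r) mul2n -addnn.
pose w := (4 * s).+1.
have cw : coprime (2 * r) w.
  have -> : (2 * r = w.-1 * 4)%N by rewrite /r /w /=; lia.
  rewrite coprimeMl coprimePn //=.
  by rewrite -[4%N]/(2 ^ 2)%N coprimeXl // coprime2n /w /= oddM.
(* Only one of the two copies of the count is rescaled. The two indicators modulo [2 * r] then add
   up to the indicator modulo [r] for each quadruple separately. *)
rewrite -[X in (_ + X)%N](sum4_scale (2 * r) w) //; last by rewrite /r; lia.
rewrite /sum4 -!big_split; apply: eq_bigr => x _.
rewrite -!big_split; apply: eq_bigr => y _.
rewrite -!big_split; apply: eq_bigr => z _.
rewrite -!big_split; apply: eq_bigr => t _ /=.
rewrite !sumsq_modn.
have -> : sumsq (w * x) (w * y) (w * z) (w * t) = (w ^ 2 * sumsq x y z t)%N.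
  by rewrite /sumsq; ring.
have -> : (w ^ 2 = 1 + r + s * (2 * r))%N by rewrite /w /r; ring.
move: (sumsq x y z t) => q.
have E : ((1 + r + s * (2 * r)) * q = (1 + r) * q %[mod 2 * r])%N.
  by rewrite mulnDl (mulnAC s) addnC modnMDl.
rewrite {}E -[in LHS](modnMmr (1 + r)).
have r8 : (8 <= r)%N by rewrite /r; lia.
have -> : (q %% r = q %% (2 * r) %% r)%N by rewrite modn_dvdm // dvdn_mull.
have : (q %% (2 * r) < 2 * r)%N by rewrite ltn_mod; lia.
move: (q %% (2 * r))%N => b bL.
rewrite (@modn_small 1 (2 * r)) ?(@modn_small 1 r); [|lia..].
(* Modulo [2 * r], the term r b depends only on the parity of [b]. *)
have -> : ((1 + r) * b = b./2 * (2 * r) + (r * odd b + b))%N.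
  have := odd_double_half b; move: b./2 (nat_of_bool (odd b)) => h o <-.
  by rewrite -muln2; ring.
rewrite modnMDl.
have rE : ~~ odd r by rewrite /r oddM.
have [br|rb] := ltnP b r.
  rewrite (@modn_small b r) // modn_small; last by case: (odd b); lia.
  case: eqP => [->|b1] /=; first by rewrite muln1; case: eqP; lia.
  by case: eqP => //; case: (odd b); lia.
have -> : (b %% r = b - r)%N.
  by rewrite -[in LHS](subnK rb) modnDr modn_small; lia.
have [bo|be] := boolP (odd b).
  have -> : (r * true + b = b - r + 2 * r)%N by lia.
  rewrite modnDr modn_small; last by lia.
  by case: (b =P 1%N); lia.
rewrite muln0 add0n modn_small //.
case: eqP => b1; first by rewrite b1 in be.
by case: eqP => // br; move: be; rewrite -(subnK rb) br oddD (negPf rE).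
Qed.

Lemma N4_pow2 (k : nat) : N4 1 (2 ^ k) = (8 ^ k)%N.
Proof.
(* Doubling needs a modulus divisible by 8, so the moduli 1, 2, 4 and 8 are evaluated directly. *)
have small j : (j < 4)%N -> N4 1 (2 ^ j) = (8 ^ j)%N.
  by case: j => [|[|[|[|//]]]] _; rewrite N4_sum4 /sum4 unlock; vm_compute.
elim: k => [|k IH]; first exact: small.
have [|k3] := ltnP k.+1 4; first exact: small.
have -> : (2 ^ k.+1 = 2 * (8 * 2 ^ (k - 3)))%N.
  by rewrite -[8%N]/(2 ^ 3)%N -expnD subnKC // expnS.
rewrite N4_double ?expn_gt0 // -[X in N4 1 (X * _)]/(2 ^ 3)%N -expnD subnKC //.
by rewrite IH -expnS.
Qed.

(** * Solving u^2 + v^2 = -1 modulo odd numbers, and the resulting determinant form *)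

(** Pigeonhole: the set [A] of squares and its image under a -> -1 - a each fill more than half of
    the field, so they meet. *)
Lemma finField_sum2sq (F : finFieldType) : odd #|F| ->
  exists u v : F, u ^+ 2 + v ^+ 2 + 1 = 0.
Proof.
move=> oF; pose A := [set x ^+ 2 | x in [set: F]]%SET.
have card_A : (#|F| < #|A| * 2)%N.
  have : (#|F| <= #|A| * 2)%N.
    (* The fibre of squaring through [x] lies in {x, -x}; oddness of the cardinal then makes the
       inequality strict. *)
    rewrite -cardsT -sum1_card (partition_big_imset (fun x : F => x ^+ 2)) /=.
    rewrite -sum_nat_const; apply: leq_sum => _ /imsetP[x _ ->].
    rewrite sum1_card; apply: (@leq_trans #|[set x; - x]%SET|); last first.
      by rewrite cards2; case: (_ != _).
    apply/subset_leq_card/fintype.subsetP => y; rewrite unfold_in /= !inE /=.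
    by rewrite eqf_sqr.
  rewrite leq_eqVlt => /orP[/eqP e|//].
  by rewrite e oddM andbF in oF.
pose B : {set F} := [set - 1 - a | a in A]%SET.
have card_B : #|B| = #|A|.
  by rewrite card_imset // => a b /addrI/oppr_inj.
have /set0Pn[w] : (A :&: B)%SET != finset.set0.
  rewrite -card_gt0; have := cardsUI A B; rewrite card_B.
  move: (max_card (mem (A :|: B)%SET)) card_A => /=.
  by move: #|(A :|: B)%SET| #|(A :&: B)%SET| #|A| #|F| => *; lia.
rewrite inE => /andP[/imsetP[u _ ->] /imsetP[_ /imsetP[v _ ->] e]].
by exists u, v; rewrite e; ring.
Qed.

Lemma prime_sum2sq (p : nat) : prime p -> odd p ->
  exists u v : nat, (p %| u ^ 2 + v ^ 2 + 1)%N.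
Proof.
move=> pp op; have [|u [v e]] := @finField_sum2sq 'F_p; first by rewrite card_Fp.
exists (val u), (val v).
rewrite (dvdn_pcharf (pchar_Fp pp)) !natrD !natrX.
by rewrite [val u]lock [val v]lock -!lock !natr_Zp e.
Qed.

(** A Hensel step that scales [u] and [v] by the same factor 1 + m h q, where u^2 + v^2 + 1 = q m
    and 2 h = m + 1. Modulo m^2 the new sum is m q + m q (u^2 + v^2) = (m q)^2, hence 0, and neither
    [u] nor [v] has to be invertible. *)
Lemma sum2sq_lift (m u v : nat) : odd m -> (m %| u ^ 2 + v ^ 2 + 1)%N ->
  exists u' v' : nat, (m ^ 2 %| u' ^ 2 + v' ^ 2 + 1)%N.
Proof.
move=> om /dvdnP[q e]; pose h := (m.+1)./2.
have h2 : (2 * h = m.+1)%N.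
  by rewrite mul2n -[RHS]odd_double_half /= om.
exists (u + m * (h * u * q))%N, (v + m * (h * v * q))%N.
apply/dvdnP; exists (q ^ 2 + q * (u ^ 2 + v ^ 2) + (h * u * q) ^ 2 + (h * v * q) ^ 2)%N.
transitivity ((u ^ 2 + v ^ 2 + 1) + (2 * h) * m * q * (u ^ 2 + v ^ 2)
   + m ^ 2 * ((h * u * q) ^ 2 + (h * v * q) ^ 2))%N; first by ring.
rewrite h2 -addn1.
transitivity (m * q * (u ^ 2 + v ^ 2 + 1) + m ^ 2 * q * (u ^ 2 + v ^ 2) +
   m ^ 2 * ((h * u * q) ^ 2 + (h * v * q) ^ 2))%N; last by rewrite e; ring.
rewrite {1}e; ring.
Qed.

Lemma sum2sq_crt (a b u v u' v' : nat) : coprime a b ->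
  (a %| u ^ 2 + v ^ 2 + 1)%N -> (b %| u' ^ 2 + v' ^ 2 + 1)%N ->
  exists x y : nat, (a * b %| x ^ 2 + y ^ 2 + 1)%N.
Proof.
move=> cab da db; exists (chinese a b u u'), (chinese a b v v').
have sq r x y : (x = y %[mod r] -> x ^ 2 = y ^ 2 %[mod r])%N.
  by move=> xy; rewrite -modnXm xy modnXm.
rewrite Gauss_dvd // /dvdn; apply/andP; split.
  rewrite (_ : _ = u ^ 2 + v ^ 2 + 1 %[mod a])%N //.
  by do 2!(apply: addn_eqmod => //); apply: sq; rewrite chinese_modl.
rewrite (_ : _ = u' ^ 2 + v' ^ 2 + 1 %[mod b])%N //.
by do 2!(apply: addn_eqmod => //); apply: sq; rewrite chinese_modr.
Qed.

(** Strong induction on m = p k with [p] the least prime factor: the Chinese remainder theorem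
    applies when [p] does not divide [k]; otherwise p k divides k^2 and the solution modulo [k] is
    lifted. *)
Lemma odd_sum2sq (m : nat) : odd m ->
  exists u v : nat, (m %| u ^ 2 + v ^ 2 + 1)%N.
Proof.
elim/ltn_ind: m => m IH om.
have [m1|m1] := leqP m 1.
  by exists 0%N, 0%N; case: m m1 om {IH} => [|[|//]].
have pp := pdiv_prime m1; set p := pdiv m in pp.
have [k mk] : exists k, m = (p * k)%N.
  by have /dvdnP[k ->] := pdiv_dvd m; exists k; rewrite mulnC.
have [op ok] : odd p /\ odd k by move: om; rewrite mk oddM => /andP.
have [u [v uv]] : exists u v : nat, (k %| u ^ 2 + v ^ 2 + 1)%N.
  apply: IH => //; rewrite mk ltn_Pmull ?prime_gt1 //; lia.
have [pk|pk] := boolP (p %| k)%N.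
  have [u' [v' uv']] := sum2sq_lift _ _ _ ok uv.
  exists u', v'; apply: dvdn_trans uv'; rewrite mk -mulnn; exact: dvdn_mul.
have [u' [v' uv']] := prime_sum2sq _ pp op.
rewrite mk; apply: sum2sq_crt uv' uv.
by rewrite prime_coprime.
Qed.

(* If [u^2 + v^2 = -1], the sum of four squares is the determinant of
   [[x + uz + vt, y + vz - ut], [-y + vz - ut, x - uz - vt]]. *)
Lemma card_sumsq_det (A : finComNzRingType) (u v h : A) :
  u ^+ 2 + v ^+ 2 + 1 = 0 -> h * 2 = 1 ->
  #|[set w : A * A * A * A | let: (x, y, z, t) := w in
      x ^+ 2 + y ^+ 2 + z ^+ 2 + t ^+ 2 == 1]%SET| =
  #|[set w : A * A * (A * A) | w.1.1 * w.2.2 - w.1.2 * w.2.1 == 1]%SET|.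
Proof.
move=> uv h2.
have u2 : u ^+ 2 = - v ^+ 2 - 1.
  by apply/eqP; rewrite -subr_eq0 -uv; apply/eqP; ring.
pose phi (w : A * A * A * A) : A * A * (A * A) := let: (x, y, z, t) := w in
  ((x + u * z + v * t, y + v * z - u * t),
   (- y + v * z - u * t, x - u * z - v * t)).
(* Half sums and differences of the entries give x, y, u z + v t and v z - u t; the last two are
   solved for z and t using u^2 + v^2 = -1. *)
pose psi (w : A * A * (A * A)) : A * A * A * A := let: ((a, b), (c, d)) := w in
  ((a + d) * h, (b - c) * h,
   - (u * ((a - d) * h) + v * ((b + c) * h)),
   - (v * ((a - d) * h) - u * ((b + c) * h))).
have phiK : cancel phi psi.
  move=> [[[x y] z] t]; rewrite /phi /psi.
  by congr (_, _, _, _); ring: u2 h2.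
have psiK : cancel psi phi.
  move=> [[a b] [c d]]; rewrite /phi /psi.
  by congr (_, _, (_, _)); ring: u2 h2.
rewrite -(card_imset _ (can_inj phiK)); apply: eq_card => w.
rewrite -[w]psiK mem_imset ?inE; last exact: can_inj phiK.
move: (psi w) => [[[x y] z] t] /=; congr (_ == _).
by ring: u2.
Qed.

(** * Matrices of determinant 1 and Jordan's totient *)

(** If a first row [p] has one completion [q0], its completions are exactly the rows q0 + t p, and
    distinct [t] give distinct rows. *)
Lemma card_det1 (A : finComNzRingType) :
  #|[set w : A * A * (A * A) | w.1.1 * w.2.2 - w.1.2 * w.2.1 == 1]%SET| =
  (#|[set p : A * A | [exists q : A * A, p.1 * q.2 - p.2 * q.1 == 1]%R]%SET|
   * #|A|)%N.
Proof.
rewrite -sum1_card big_mkcond /=.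
rewrite (eq_bigr (fun w : A * A * (A * A) =>
  (w.1.1 * w.2.2 - w.1.2 * w.2.1 == 1 : nat))); last first.
  by move=> w _; rewrite inE; case: (_ == _).
rewrite -(pair_bigA _ (fun p q : A * A => (p.1 * q.2 - p.2 * q.1 == 1 : nat))) /=.
rewrite -sum_nat_const [RHS]big_mkcond /=; apply: eq_bigr => p _; rewrite inE.
case: existsP => [[q0 /eqP q0P]|np]; last first.
  by rewrite big1 // => q _; case: eqP => // /eqP qP; case: np; exists q.
pose phi (t : A) := (q0.1 + t * p.1, q0.2 + t * p.2).
have phi_inj : injective phi.
  move=> s t [/addrI s1 /addrI s2].
  by rewrite -[s]mulr1 -[t]mulr1 -q0P !mulrBr !mulrA s1 s2.
rewrite -[RHS]cardsT -(card_imset _ phi_inj) -sum1_card [RHS]big_mkcond.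
apply: eq_bigr => q _; suff -> : (q \in phi @: [set: A]%SET) =
    (p.1 * q.2 - p.2 * q.1 == 1) by case: (_ == _).
apply/imsetP/eqP => [[t _ ->] /=|qP]; first by rewrite -q0P; ring.
(* Cramer's rule: if q - q0 = t p, then det (q - q0, q0) = t det (p, q0) = t. *)
exists ((q.1 - q0.1) * q0.2 - (q.2 - q0.2) * q0.1) => //.
rewrite [q in LHS]surjective_pairing /phi; congr (_, _).
  transitivity (q0.1 + (q.1 - q0.1) * (p.1 * q0.2 - p.2 * q0.1) + q0.1 *
    (p.1 * q0.2 - p.2 * q0.1 - (p.1 * q.2 - p.2 * q.1))); last by ring.
  by rewrite q0P qP; ring.
transitivity (q0.2 + (q.2 - q0.2) * (p.1 * q0.2 - p.2 * q0.1) + q0.2 *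
  (p.1 * q0.2 - p.2 * q0.1 - (p.1 * q.2 - p.2 * q.1))); last by ring.
by rewrite q0P qP; ring.
Qed.

Lemma eqr_Zp_nat (m a b : nat) : (1 < m)%N ->
  (a%:R == b%:R :> 'Z_m) = (a == b %[mod m])%N.
Proof. by move=> m1; rewrite -val_eqE /= !val_Zp_nat. Qed.

(** A common divisor of [a], [b] and [m] divides 1 as soon as a completion exists; conversely, two
    Bezout relations, for (a, b) and for (gcd, m), produce one. *)
Lemma unimodular_Zp (m : nat) (a b : 'Z_m) : (1 < m)%N ->
  [exists q : 'Z_m * 'Z_m, a * q.2 - b * q.1 == 1] = coprime (gcdn a b) m.
Proof.
move=> m1; apply/existsP/idP => [[[c d] /= /eqP e]|].
  have : (a%:R * d%:R == (1 + b * c)%:R :> 'Z_m).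
    by rewrite natrD natrM !natr_Zp -e; apply/eqP; ring.
  rewrite -natrM eqr_Zp_nat // => /eqP adbc.
  set g := gcdn (gcdn a b) m; rewrite /coprime -/g -dvdn1.
  have gm : (g %| m)%N by exact: dvdn_gcdr.
  have gab : (g %| gcdn a b)%N by exact: dvdn_gcdl.
  have ga : (g %| a)%N by apply: dvdn_trans gab (dvdn_gcdl _ _).
  have gb : (g %| b)%N by apply: dvdn_trans gab (dvdn_gcdr _ _).
  have : (g %| a * d)%N by rewrite dvdn_mulr.
  rewrite /dvdn -(modn_dvdm _ gm) adbc modn_dvdm // -/(g %| 1 + b * c)%N.
  by rewrite dvdn_addl // dvdn_mulr.
move=> cop.
have [u [v uv]] := Bezoutz (val a)%:Z (val b)%:Z.
have [s [t st]] := Bezoutz (gcdn a b)%:Z m%:Z.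
have e : (s * (u * (val a)%:Z + v * (val b)%:Z) + t * m%:Z = 1)%R.
  by rewrite uv /gcdz !absz_nat st /gcdz !absz_nat (eqP cop).
exists (- (s * v)%:~R, (s * u)%:~R) => /=.
have {e} := congr1 (fun z : int => z%:~R : 'Z_m) e.
rewrite !(rmorphD, rmorphM) /= -!pmulrn !natr_Zp.
rewrite (_ : (m%:R : 'Z_m) = 0); last by rewrite pchar_Zp.
by move=> e; apply/eqP; apply: etrans e; ring.
Qed.

(** Jordan's totient J_2, as the number of first rows of matrices of determinant 1 over Z/m. *)
Definition jordan2 (m : nat) : nat :=
  (\sum_(0 <= a < m) \sum_(0 <= b < m) coprime (gcdn a b) m)%N.

Lemma N4_odd (m : nat) : odd m -> N4 1 m = (m * jordan2 m)%N.
Proof.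
case: m => [//|[_|m om]].
  (* The modulus 1 is treated apart, since ['Z_1] has two elements. *)
  by rewrite (N4_pow2 0) /jordan2 !big_nat1.
have m1 : (1 < m.+2)%N by [].
have [u [v uv]] := odd_sum2sq _ om.
have uv0 : (u%:R : 'Z_m.+2) ^+ 2 + v%:R ^+ 2 + 1 = 0.
  have : ((u ^ 2 + v ^ 2 + 1)%N%:R == 0%:R :> 'Z_m.+2).
    by rewrite eqr_Zp_nat // mod0n.
  by rewrite !natrD !natrX => /eqP.
(* Half of the modulus plus one is the inverse of 2. *)
have h2 : ((m.+3)./2%:R : 'Z_m.+2) * 2 = 1.
  have : (((m.+3)./2 * 2)%N%:R == 1%:R :> 'Z_m.+2).
    rewrite eqr_Zp_nat // muln2; have -> : (m.+3./2.*2 = m.+2 + 1)%N.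
      by rewrite -[RHS]odd_double_half addn1 oddS om.
    by rewrite modnDl.
  by rewrite natrM => /eqP.
transitivity #|[set w : 'Z_m.+2 * 'Z_m.+2 * 'Z_m.+2 * 'Z_m.+2 |
    let: (x, y, z, t) := w in x ^+ 2 + y ^+ 2 + z ^+ 2 + t ^+ 2 == 1]%SET|.
  rewrite /N4; apply: eq_card => -[[[x y] z] t]; rewrite !inE.
  rewrite -eqr_Zp_nat // !natrD !natrX.
  by rewrite (natr_Zp x) (natr_Zp y) (natr_Zp z) (natr_Zp t).
rewrite (card_sumsq_det _ _ _ _ uv0 h2) card_det1 card_ord mulnC; congr muln.
rewrite -sum1_card big_mkcond /= /jordan2 big_mkord.
under [RHS]eq_bigr => a _ do rewrite big_mkord.
rewrite [RHS]pair_bigA /=; apply: eq_bigr => -[a b] _ /=.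
by rewrite inE /= unimodular_Zp //; case: (coprime _ _).
Qed.

(** * Divisor sums of the count *)

Lemma sum_dvdn (e k : nat) (F : nat -> nat) : (0 < e)%N ->
  (\sum_(0 <= a < e * k | e %| a) F a = \sum_(0 <= a < k) F (e * a))%N.
Proof.
move=> e0; elim: k => [|k IH]; first by rewrite muln0 !big_geq.
rewrite big_nat_recr //= -IH (@big_cat_nat _ _ _ (e * k)) //=; last first.
  by rewrite leq_mul2l leqnSn orbT.
congr addn; rewrite big_ltn_cond ?ltn_mul2l ?e0 //= dvdn_mulr // big1_seq ?addn0 //.
move=> i /andP[/dvdnP[j ->]]; rewrite mem_index_iota => /andP[].
by rewrite (mulnC j) !ltn_mul2l e0 /= => kj; rewrite ltnS leqNgt kj.
Qed.

(** Only pairs of multiples of [e] contribute, and dividing by [e] leaves the coprimality condition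
    modulo [k]. *)
Lemma sum_gcd_eq (e k : nat) : (0 < e)%N ->
  (\sum_(0 <= a < e * k) \sum_(0 <= b < e * k) (gcdn (gcdn a b) (e * k) == e) =
   jordan2 k)%N.
Proof.
move=> e0.
transitivity (\sum_(0 <= a < e * k | e %| a) \sum_(0 <= b < e * k | e %| b)
    (gcdn (gcdn a b) (e * k) == e))%N.
  rewrite [RHS]big_mkcond; apply: eq_bigr => a _; rewrite [in RHS]big_mkcond.
  have [da|da] := boolP (e %| a)%N; last first.
    rewrite big1 // => b _; case: eqP => // ge; case/negP: da.
    by rewrite -ge (dvdn_trans (dvdn_gcdl _ _)) // dvdn_gcdl.
  apply: eq_bigr => b _; have [//|db] := boolP (e %| b)%N.
  case: eqP => // ge; case/negP: db.
  by rewrite -ge (dvdn_trans (dvdn_gcdl _ _)) // dvdn_gcdr.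
rewrite sum_dvdn //; apply: eq_bigr => a _; rewrite sum_dvdn //.
apply: eq_bigr => b _; rewrite -!muln_gcdr -[X in (_ == X)]muln1 eqn_pmul2l //.
Qed.

(** The m^2 pairs are sorted by their gcd with [m]. The bound [N] keeps the range of [e] independent
    of [m], so that sums can be exchanged later. *)
Lemma sum_jordan2 (m N : nat) : (0 < m <= N)%N ->
  (\sum_(1 <= e < N.+1 | e %| m) jordan2 (m %/ e) = m ^ 2)%N.
Proof.
move=> /andP[m0 mN].
transitivity (\sum_(1 <= e < N.+1 | e %| m) \sum_(0 <= a < m) \sum_(0 <= b < m)
    (gcdn (gcdn a b) m == e))%N.
  rewrite big_nat_cond [RHS]big_nat_cond; apply: eq_bigr => e /andP[/andP[e0 _] em].
  by rewrite -(sum_gcd_eq e _ e0) mulnC divnK.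
rewrite exchange_big /= (eq_bigr (fun=> m)); last first.
  move=> a _; rewrite exchange_big /= (eq_bigr (fun=> 1%N)); last first.
    move=> b _; set g := gcdn _ m; have gm : (g %| m)%N by exact: dvdn_gcdr.
    have gI : g \in index_iota 1 N.+1.
      by rewrite mem_index_iota gcdn_gt0 m0 orbT ltnS (leq_trans _ mN) // dvdn_leq.
    rewrite big_mkcond (bigD1_seq g) ?iota_uniq //= gm eqxx big1 // => i.
    by rewrite eq_sym => /negPf ->; case: ifP.
  by rewrite sum_nat_const_nat subn0 muln1.
by rewrite sum_nat_const_nat subn0 mulnn.
Qed.

(** Write r = 2^k m with [m] odd. The odd divisors of [r] are the divisors [e] of [m], and each term
    equals e 8^k (m/e) J_2(m/e) = 8^k m J_2(m/e). *)
Lemma sum_odd_divisors_N4 (r N : nat) : (0 < r <= N)%N ->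
  (\sum_(1 <= e < N.+1 | odd e && (e %| r)) e * N4 1 (r %/ e) = r ^ 3)%N.
Proof.
move=> /andP[r0 rN].
have [m [k [om rE]]] : exists m k, odd m /\ r = (2 ^ k * m)%N.
  have [m] := pfactor_coprime (isT : prime 2) r0.
  rewrite coprime2n => om ->; exists m, (logn 2 r); split=> //.
  by rewrite mulnC.
have m0 : (0 < m)%N by case: m om {rE}.
have mN : (m <= N)%N.
  by rewrite (leq_trans _ rN) // rE leq_pmull // expn_gt0.
transitivity (8 ^ k * m * \sum_(1 <= e < N.+1 | e %| m) jordan2 (m %/ e))%N;
    last first.
  rewrite sum_jordan2 ?m0 // rE expnMn -expnM (mulnC k) expnM.
  by rewrite -[(2 ^ 3)%N]/8%N; ring.
rewrite big_distrr /=; apply: congr_big => // [e|e em].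
  have [om'|//] := boolP (odd e).
    rewrite /= rE Gauss_dvdr // coprime_sym coprimeXl // coprime2n //.
  move=> /negPf oe; apply/esym/negP => em.
  by have := dvdn_odd em om; rewrite oe.
have /andP[oe er] := em.
have {}em : (e %| m)%N.
  by move: er; rewrite rE Gauss_dvdr // coprime_sym coprimeXl // coprime2n.
have od : odd (m %/ e) by move: om; rewrite -{1}(divnK em) oddM => /andP[].
have cop : coprime (2 ^ k) (m %/ e) by rewrite coprimeXl // coprime2n.
rewrite rE -muln_divA // N4_mul ?expn_gt0 ?(odd_gt0 od) //.
by rewrite N4_pow2 N4_odd // -[X in (8 ^ k * X * _)%N](divnK em); ring.
Qed.

(** Stated for any monoid law because it serves both natural and real sums. *)
Lemma big_dvdn_quotient (T : Type) (idx : T) (op : Monoid.law idx) (e n : nat)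
    (F : nat -> T) : (0 < e)%N ->
  \big[op/idx]_(1 <= r < n.+1 | (e %| r)%N) F (r %/ e)%N =
  \big[op/idx]_(1 <= d < (n %/ e).+1) F d.
Proof.
move=> e0; elim: n => [|n IH]; first by rewrite div0n !big_geq.
rewrite big_mkcond big_nat_recr //= -big_mkcond IH divnS //.
case: (e %| n.+1)%N; last by rewrite Monoid.mulm1.
by rewrite add1n [in RHS]big_nat_recr.
Qed.

Lemma sum_odd_N4 (n : nat) :
  (\sum_(1 <= e < n.+1 | odd e) e * (\sum_(1 <= d < (n %/ e).+1) N4 1 d) =
   \sum_(1 <= r < n.+1) r ^ 3)%N.
Proof.
transitivity (\sum_(1 <= r < n.+1) \sum_(1 <= e < n.+1 | odd e && (e %| r))
    e * N4 1 (r %/ e))%N; last first.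
  by apply: eq_big_nat => r /andP[r0 rn]; rewrite sum_odd_divisors_N4 // r0.
under [RHS]eq_bigr => r _ do rewrite big_mkcondr.
rewrite exchange_big /=.
rewrite big_nat_cond [RHS]big_nat_cond; apply: eq_bigr => e /andP[/andP[e0 _] _].
by rewrite -big_mkcond /= -big_dvdn_quotient // big_distrr.
Qed.

(** * Elementary real sums and the partial sums of zeta(3) *)

Lemma sum_cubes (R : realType) (n : nat) :
  \sum_(1 <= r < n.+1) (r%:R : R) ^+ 3 = n%:R ^+ 2 * (n%:R + 1) ^+ 2 / 4.
Proof.
elim: n => [|n IH]; first by rewrite big_geq // expr0n !mul0r.
by rewrite big_nat_recr //= IH -natr1; field.
Qed.

Lemma sum_odd_inv_sq (R : realType) (n : nat) :
  \sum_(2 <= e < n.+1 | odd e) (e%:R ^+ 2)^-1 <= 1 / 2 :> R.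
Proof.
have [n2|n2] := ltnP n 2; first by rewrite big_geq // divr_ge0.
(* The bound is strengthened to 1/2 - 1/n for the induction; it telescopes by 1/(n+1)^2 <= 1/n -
   1/(n+1). *)
apply: (@le_trans _ _ (1 / 2 - n%:R^-1)); last by rewrite gerBl invr_ge0.
elim: n n2 => // n IH; rewrite ltnS leq_eqVlt => /orP[/eqP <-|n2].
  by rewrite big_mkcond big_nat1 /= mul1r subrr.
rewrite big_mkcond big_nat_recr /=; last by lia.
have n1 : (0 < n)%N by lia.
have n0 : 0 < n%:R :> R by rewrite ltr0n.
have step : (n.+1%:R ^+ 2)^-1 <= n%:R^-1 - n.+1%:R^-1 :> R.
  have -> : n%:R^-1 - n.+1%:R^-1 = (n%:R * n.+1%:R)^-1 :> R.
    by rewrite -natr1; field; lra.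
  rewrite lef_pV2 ?posrE ?exprn_gt0 ?mulr_gt0 ?ltr0n //.
  by rewrite -natr1; nra.
have := IH n2; rewrite big_mkcond /=; case: ifP => _ H.
  by apply: (le_trans (lerD H step)); move: n%:R^-1 n.+1%:R^-1 => a b; lra.
rewrite addr0 (le_trans H) // lerD2l lerN2 lef_pV2 ?posrE ?ltr0n //.
by rewrite ler_nat.
Qed.

Definition invcubes (R : realType) (n : nat) : R :=
  \sum_(1 <= k < n.+1) (k%:R ^+ 3)^-1.

Lemma invcubes_le (R : realType) (m n : nat) : (m <= n)%N ->
  invcubes R m <= invcubes R n.
Proof.
move=> mn; rewrite /invcubes (@big_cat_nat _ _ _ m.+1 1 n.+1) //= lerDl.
by apply: sumr_ge0 => i _; rewrite invr_ge0 exprn_ge0.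
Qed.

(** Telescoping with 1/k^3 <= 2/(k (k+1)) = 2/k - 2/(k+1); the induction carries the extra term
    -2/(n+1). *)
Lemma invcubes_tail (R : realType) (m n : nat) : (m <= n)%N ->
  invcubes R n <= invcubes R m + 2 / m.+1%:R.
Proof.
move=> mn; apply: (@le_trans _ _ (invcubes R m + 2 / m.+1%:R - 2 / n.+1%:R)).
  rewrite -(subnKC mn); elim: (n - m)%N => [|k IH].
    by rewrite addn0 addrK.
  rewrite addnS {1}/invcubes big_nat_recr //= -/(invcubes R (m + k)).
  move: IH; set N := (m + k)%N; move=> IH.
  have N0 : 0 <= N%:R :> R by [].
  have -> : 2 / N.+2%:R = 2 / N.+1%:R - 2 / (N.+1%:R * N.+2%:R) :> R.
    by rewrite -!natr1; field; lra.
  have step : (N.+1%:R ^+ 3)^-1 <= 2 / (N.+1%:R * N.+2%:R) :> R.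
    rewrite -[_^-1]mul1r ler_pdivrMr ?exprn_gt0 ?ltr0n //.
    rewrite mulrAC ler_pdivlMr ?mulr_gt0 ?ltr0n //.
    by rewrite -!natr1; nra.
  apply: (le_trans (lerD IH step)).
  by rewrite opprB addrA addrAC.
by rewrite gerBl divr_ge0.
Qed.

Lemma zeta3_invcubes (R : realType) (m : nat) :
  invcubes R m <= zeta (3 : R) <= invcubes R m + 2 / m.+1%:R.
Proof.
have serE : series (riemannR (3 : R)) = invcubes R.
  apply/funext => n; rewrite /series /invcubes /= big_add1 /=.
  by apply: eq_bigr => i _; rewrite /riemannR powR_mulrn.
have cv : cvgn (invcubes R).
  apply: nondecreasing_is_cvgn; first by move=> i j; exact: invcubes_le.
  exists (invcubes R 0 + 2 / 1) => _ [n _ <-]; exact: invcubes_tail.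
rewrite /zeta serE; apply/andP; split.
  apply: limr_ge => //; near=> n; apply: invcubes_le; near: n.
  exact: nbhs_infty_ge.
apply: limr_le => //; near=> n; apply: invcubes_tail; near: n.
exact: nbhs_infty_ge.
Unshelve. all: by end_near. Qed.

Lemma zeta3_ge1 (R : realType) : 1 <= zeta (3 : R).
Proof.
have /andP[+ _] := zeta3_invcubes R 1.
by rewrite /invcubes big_nat1 expr1n invr1.
Qed.

(** The even terms, e = 2 d, form one eighth of the partial sum up to n/2. *)
Lemma sum_odd_invcubes (R : realType) (n : nat) :
  \sum_(1 <= e < n.+1 | odd e) (e%:R ^+ 3)^-1 =
  invcubes R n - invcubes R (n %/ 2) / 8.
Proof.
apply/eqP; rewrite eq_sym subr_eq; apply/eqP.
rewrite [LHS](bigID odd) /=; congr (_ + _).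
transitivity (\sum_(1 <= e < n.+1 | (2 %| e)%N) ((2 * (e %/ 2)%:R) ^+ 3)^-1 : R).
  apply: congr_big => // e; first by rewrite dvdn2.
  by move=> oe; rewrite -natrM mulnC divnK // dvdn2.
rewrite (big_dvdn_quotient _ _ _ 2 n (fun d => ((2 * d%:R) ^+ 3)^-1)) //.
rewrite /invcubes mulr_suml; apply: eq_bigr => d _.
by rewrite exprMn invfM mulrC; congr (_ / _); ring.
Qed.

(** The error is the tail of zeta(3) beyond [n], at most 2/n, minus one eighth of the tail beyond
    n/2, itself at most 4/n. *)
Lemma sum_odd_invcubes_zeta (R : realType) (n : nat) : (0 < n)%N ->
  `|7 / 8 * zeta (3 : R) - \sum_(1 <= e < n.+1 | odd e) (e%:R ^+ 3)^-1|
    <= 3 / n%:R.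
Proof.
move=> n0; rewrite sum_odd_invcubes.
have /andP[a1 a2] := zeta3_invcubes R n.
have /andP[b1 b2] := zeta3_invcubes R (n %/ 2).
have n0' : 0 < n%:R :> R by rewrite ltr0n.
have c1 : 2 / n.+1%:R <= 2 / n%:R :> R.
  by rewrite ler_pM2l // lef_pV2 ?posrE ?ltr0n // ler_nat.
have c2 : 2 / (n %/ 2).+1%:R <= 4 / n%:R :> R.
  rewrite ler_pdivrMr ?ltr0n // mulrAC ler_pdivlMr // -!natrM ler_nat.
  by have := ltn_ceil n (isT : (0 < 2)%N); lia.
move: c1 c2 a2 b2; rewrite -[2 / n%:R]/(2 * n%:R^-1) -[4 / n%:R]/(4 * n%:R^-1).
rewrite -[3 / n%:R]/(3 * n%:R^-1).
move: n%:R^-1 (2 / n.+1%:R) (2 / (n %/ 2).+1%:R) => a b b' c1 c2 a2 b2.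
by rewrite ler_norml; apply/andP; split; lra.
Qed.

(** * The error term of the summatory function *)

(** Transfers an estimate from an integer part [m] to the real number [y], at the cost y^4 - m^4 <=
    4 y^3. *)
Lemma quartic_shift (R : realType) (c K s m y : R) :
  0 <= c -> 0 <= K -> 0 <= m -> m <= y <= m + 1 ->
  `|s - c * m ^+ 4| <= K * m ^+ 3 -> `|s - c * y ^+ 4| <= (K + 4 * c) * y ^+ 3.
Proof.
move=> c0 K0 m0 /andP[my ym] H.
have y0 : 0 <= y by lra.
have h3 : m ^+ 3 <= y ^+ 3 by rewrite lerXn2r.
have h4 : m ^+ 4 <= y ^+ 4 by rewrite lerXn2r.
have h : y ^+ 4 - m ^+ 4 <= 4 * y ^+ 3.
  have -> : y ^+ 4 - m ^+ 4 = (y - m) * (y ^+ 3 + y ^+ 2 * m + y * m ^+ 2 + m ^+ 3).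
    by ring.
  have h1 : y ^+ 2 * m <= y ^+ 3 by rewrite [leRHS]exprSr ler_wpM2l ?exprn_ge0.
  have h2 : y * m ^+ 2 <= y ^+ 3 by rewrite [leRHS]exprS ler_wpM2l // lerXn2r.
  have q0 : 0 <= y ^+ 3 by rewrite exprn_ge0.
  have : 0 <= y ^+ 3 + y ^+ 2 * m + y * m ^+ 2 + m ^+ 3.
    by rewrite !addr_ge0 ?mulr_ge0 ?exprn_ge0.
  nra.
have -> : s - c * y ^+ 4 = (s - c * m ^+ 4) - c * (y ^+ 4 - m ^+ 4) by ring.
rewrite (le_trans (ler_normB _ _)) // mulrDl lerD //.
  by rewrite (le_trans H) // ler_wpM2l.
by rewrite ger0_norm ?mulr_ge0 ?subr_ge0 // [4 * c]mulrC -mulrA ler_wpM2l.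
Qed.

Definition N4_sum (n : nat) : nat := (\sum_(1 <= r < n.+1) N4 1 r)%N.

(* Isolating [e = 1] in [sum_odd_N4] bounds the error at [n] by at most half of
   the bound for the errors at [n / e], since the [1 / e ^ 2] with [e >= 3] odd
   sum up to at most [1 / 2]. *)
Lemma N4_sum_error (R : realType) (c : R) :
  0 <= c -> c * (7 / 8 * zeta (3 : R)) = 1 / 4 -> forall n : nat,
  `|(N4_sum n)%:R - c * n%:R ^+ 4| <= (2 + 10 * c) * n%:R ^+ 3.
Proof.
(* [K] solves K = 1 + 3 c + (K + 4 c) / 2, the three summands being the bounds [T_le], [O_le] and
   [E_le], so the induction closes exactly. *)
move=> c0 cz; set K := 2 + 10 * c; have K0 : 0 <= K by rewrite /K; lra.
elim/ltn_ind => n IH.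
have [->|n0] := posnP n.
  by rewrite /N4_sum big_geq // !expr0n /= !mulr0 subrr normr0.
set x : R := n%:R; have x0 : 0 < x by rewrite ltr0n.
have x0' : 0 <= x := ltW x0.
pose O : R := \sum_(1 <= e < n.+1 | odd e) (e%:R ^+ 3)^-1.
have OE : O = 1 + \sum_(2 <= e < n.+1 | odd e) (e%:R ^+ 3)^-1.
  by rewrite /O big_ltn_cond //= expr1n invr1.
pose T : R := \sum_(1 <= r < n.+1) r%:R ^+ 3.
have TE : T = (N4_sum n)%:R +
    \sum_(2 <= e < n.+1 | odd e) e%:R * (N4_sum (n %/ e))%:R.
  transitivity ((\sum_(1 <= e < n.+1 | odd e) e * N4_sum (n %/ e))%N%:R : R).
    rewrite sum_odd_N4 natr_sum; by apply: eq_bigr => r _; rewrite natrX.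
  rewrite big_ltn_cond //= divn1 mul1n natrD natr_sum; congr (_ + _).
  by apply: eq_bigr => e _; rewrite natrM.
(* Three errors: the sum of cubes against x^4/4, the truncated series [O] against its limit, and the
   inductive errors at n/e. *)
have -> : (N4_sum n)%:R - c * x ^+ 4 = (T - x ^+ 4 / 4) + x ^+ 4 * (1 / 4 - c * O)
   - \sum_(2 <= e < n.+1 | odd e)
       (e%:R * ((N4_sum (n %/ e))%:R - c * (x / e%:R) ^+ 4)).
  rewrite TE OE.
  have -> : \sum_(2 <= e < n.+1 | odd e)
       (e%:R * ((N4_sum (n %/ e))%:R - c * (x / e%:R) ^+ 4)) =
     \sum_(2 <= e < n.+1 | odd e) e%:R * (N4_sum (n %/ e))%:R -
     c * x ^+ 4 * \sum_(2 <= e < n.+1 | odd e) (e%:R ^+ 3)^-1.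
    rewrite mulr_sumr -sumrB big_nat_cond [RHS]big_nat_cond.
    apply: eq_bigr => e /andP[/andP[e2 _] _]; field.
    by rewrite pnatr_eq0; lia.
  by field.
have T_le : `|T - x ^+ 4 / 4| <= x ^+ 3.
  rewrite /T sum_cubes -/x.
  have x1 : 1 <= x by rewrite /x ler1n.
  have -> : x ^+ 2 * (x + 1) ^+ 2 / 4 - x ^+ 4 / 4 = x ^+ 2 * (x / 2 + 1 / 4).
    by field.
  rewrite ger0_norm; last by rewrite mulr_ge0 ?exprn_ge0 //; lra.
  by rewrite [leRHS]exprSr ler_wpM2l ?exprn_ge0 //; lra.
have O_le : `|x ^+ 4 * (1 / 4 - c * O)| <= 3 * c * x ^+ 3.
  rewrite -cz -mulrBr normrM (ger0_norm (exprn_ge0 4 x0')) normrM (ger0_norm c0).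
  have -> : 3 * c * x ^+ 3 = x ^+ 4 * (c * (3 / x)).
    by field; rewrite gt_eqF.
  rewrite ler_wpM2l ?exprn_ge0 // ler_wpM2l //.
  exact: sum_odd_invcubes_zeta.
have E_le : `|\sum_(2 <= e < n.+1 | odd e)
    (e%:R * ((N4_sum (n %/ e))%:R - c * (x / e%:R) ^+ 4))|
    <= (K + 4 * c) * x ^+ 3 * (1 / 2).
  rewrite (le_trans (ler_norm_sum _ _ _)) //.
  apply: le_trans (ler_wpM2l _ (sum_odd_inv_sq R n)); last first.
    by rewrite mulr_ge0 ?exprn_ge0 //; lra.
  rewrite mulr_sumr big_nat_cond [leRHS]big_nat_cond.
  apply: ler_sum => e /andP[/andP[e2 en] _].
  have e0 : 0 < e%:R :> R by rewrite ltr0n; lia.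
  rewrite normrM (ger0_norm (ltW e0)).
  have -> : (K + 4 * c) * x ^+ 3 * (e%:R ^+ 2)^-1 =
      e%:R * ((K + 4 * c) * (x / e%:R) ^+ 3).
    by field; rewrite gt_eqF.
  rewrite ler_wpM2l ?(ltW e0) //.
  (* The induction hypothesis holds at the integer quotient, which is below [n] as e >= 2; the shift
     moves it to the real x/e. *)
  apply: (quartic_shift _ _ _ _ (n %/ e)%:R) => //; last exact/IH/ltn_Pdiv.
  rewrite ler_pdivlMr // ler_pdivrMr // -natrM ler_nat leq_trunc_div /=.
  by rewrite natr1 -natrM ler_nat ltnW // ltn_ceil //; lia.
apply: (le_trans (ler_normB _ _)).
apply: (le_trans (lerD (ler_normD _ _) (lexx _))).
apply: (le_trans (lerD (lerD T_le O_le) E_le)).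
by rewrite /K le_eqVlt; apply/orP; left; apply/eqP; field.
Qed.

Theorem proposition44 (R : realType) :
  (fun x : R => \sum_(1 <= r < (Num.truncn x).+1) (N4 1 r)%:R : R^o)
    = (fun x : R => 2 / (7 * zeta (3 : R)) * x ^+ 4 : R^o)
      +O_ (+oo_R) (fun x : R => x ^+ 3 : R^o).
Proof.
have z1 := zeta3_ge1 R.
set c := 2 / (7 * zeta (3 : R)).
have c0 : 0 <= c by rewrite /c divr_ge0 ?mulr_ge0 // (le_trans ler01).
have cz : c * (7 / 8 * zeta (3 : R)) = 1 / 4.
  by rewrite /c; field; rewrite gt_eqF // (lt_le_trans ltr01).
apply/eqaddOP.
(* The constant 2 + 10 c at integers, plus 4 c for passing from the integer part to [x]. *)
exists (2 + 14 * c); split; first by rewrite num_real.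
move=> k ck; near=> x.
have x0 : 0 <= x by near: x; exact: nbhs_pinfty_ge.
rewrite /= (ger0_norm (exprn_ge0 3 x0)).
apply: (@le_trans _ _ ((2 + 10 * c + 4 * c) * x ^+ 3)); last first.
  by rewrite ler_wpM2r ?exprn_ge0 //; lra.
have /andP[nx xn] := truncn_itv x0.
have := N4_sum_error R c c0 cz (Num.truncn x); rewrite /N4_sum natr_sum.
apply: quartic_shift => //; first by lra.
by rewrite nx natr1 ltW.
Unshelve. all: by end_near. Qed.
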